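(* For every $n\ge 1$, the set of all reduced bumpless pipe dreams of size $n$ is connected under $2\times2$ flips that preserve reducedness together with droops and undroops; that is, the graph whose vertices are the reduced BPDs of size $n$ and whose edges join two reduced BPDs related by a single $2\times 2$ flip, droop, or undroop, is connected.
   Context: Cells of the $n\times n$ grid are indexed $(i,j)$, row $i$ top to bottom, column $j$ left to right. A bumpless pipe dream (BPD) is a tiling of the grid by the tiles empty, cross, horizontal (west–east segment), vertical (south–north), r-elbow (joining south and east edge midpoints), j-elbow (joining north and west), such that segments match across adjacent cells, no segment touches the north or west boundary, and every edge on the south and east boundary carries a segment. This yields $n$ pipes traveling north/east from the south boundary to the east boundary; a BPD is reduced if each pair of pipes crosses (shares a cross tile) at most once. Height function: $h_D(a,0)=0$ and for $1\le b\le n$, $h_D(a,b)$ is the number of $j\le a$ such that the south edge of cell $(b,j)$ carries a segment ($0\le a\le n$). A $2\times2$ flip at an interior grid point (between rows $b,b+1$ and columns $a,a+1$, $1\le a,b\le n-1$) replaces the tiles of the four surrounding cells by another tiling so that the result is a BPD whose height function differs only at $(a,b)$, by $\pm 1$. Droop: let $R$ be a rectangle of cells (rows $i_1<i_2$, columns $j_1<j_2$). $R$ is droopable if its northwest corner cell is an r-elbow, its southeast corner cell is empty, and no non-corner cell of $R$ is an elbow. The droop at $R$ makes the NW corner empty, the SE corner a j-elbow, the NE and SW corners r-elbows; on the non-corner cells of the north border, horizontal$\to$empty and cross$\to$vertical; on the west border, vertical$\to$empty and cross$\to$horizontal; on the south border, empty$\to$horizontal and vertical$\to$cross; on the east border,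 empty$\to$vertical and horizontal$\to$cross; interior cells unchanged. The undroop is the inverse move, applicable when the NW corner is empty, the SE corner is a j-elbow, the NE and SW corners are r-elbows, and no non-corner cell of $R$ is an elbow. *)

(* Defs.v *)
From HB Require Import structures.
From mathcomp Require Import all_boot all_order all_algebra.

Set Implicit Arguments.
Unset Strict Implicit.
Unset Printing Implicit Defensive.

(* [RElbow] joins the south and east edge midpoints of its cell, [JElbow] the
   north and west ones. *)
Inductive tile := Empty | Cross | Horizontal | Vertical | RElbow | JElbow.

(* Whether the tile has a segment ending on the given edge of its cell. *)
Definition north (t : tile) : bool :=
  match t with Cross | Vertical | JElbow => true | _ => false end.
Definition south (t : tile) : bool :=
  match t with Cross | Vertical | RElbow => true | _ => false end.
Definition east (t : tile) : bool :=
  match t with Cross | Horizontal | RElbow => true | _ => false end.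
Definition west (t : tile) : bool :=
  match t with Cross | Horizontal | JElbow => true | _ => false end.

Definition tile_code (t : tile) := (north t, south t, east t, west t).
Definition tile_decode (c : bool * bool * bool * bool) : option tile :=
  match c with
  | (false, false, false, false) => Some Empty
  | (true, true, true, true) => Some Cross
  | (false, false, true, true) => Some Horizontal
  | (true, true, false, false) => Some Vertical
  | (false, true, true, false) => Some RElbow
  | (true, false, false, true) => Some JElbow
  | _ => None
  end.
Lemma tile_codeK : pcancel tile_code tile_decode.
Proof. by case. Qed.

HB.instance Definition _ := Finite.copy tile (pcan_type tile_codeK).

Definition elbow (t : tile) : bool := (t == RElbow) || (t == JElbow).

(* Cells are indexed from 0: the entry [D i j] is the tile of the cell in row
   [i.+1] (from the top) and column [j.+1] (from the left). *)
Definition is_bpd (n : nat) (D : 'M[tile]_n) : bool :=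
  [&& [forall i : 'I_n, forall j : 'I_n, forall j' : 'I_n,
         (j' == j.+1 :> nat) ==> (east (D i j) == west (D i j'))],
      [forall i : 'I_n, forall i' : 'I_n, forall j : 'I_n,
         (i' == i.+1 :> nat) ==> (south (D i j) == north (D i' j))],
      [forall i : 'I_n, forall j : 'I_n, (i == 0 :> nat) ==> ~~ north (D i j)],
      [forall i : 'I_n, forall j : 'I_n, (j == 0 :> nat) ==> ~~ west (D i j)],
      [forall i : 'I_n, forall j : 'I_n, (i.+1 == n) ==> south (D i j)]
    & [forall i : 'I_n, forall j : 'I_n, (j.+1 == n) ==> east (D i j)]].

(* Pipes are followed north and east.  The flag [s] tells through which edge
   the pipe enters a cell: the south one if [s = true], the west one if
   [s = false]. *)
Definition exits_north (t : tile) (s : bool) : bool :=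
  match t, s with
  | Cross, true | Vertical, true | JElbow, false => true
  | _, _ => false
  end.
Definition exits_east (t : tile) (s : bool) : bool :=
  match t, s with
  | Cross, false | Horizontal, false | RElbow, true => true
  | _, _ => false
  end.

Definition pipe_step (n : nat) (D : 'M[tile]_n) : rel ('I_n * 'I_n * bool) :=
  fun x y =>
    let: (i, j, s) := x in
    let: (i', j', s') := y in
    if s' then [&& exits_north (D i j) s, i == i'.+1 :> nat & j' == j]
    else [&& exits_east (D i j) s, i' == i & j' == j.+1 :> nat].

(* The cells visited by the pipe that starts on the south boundary in
   column [p]. *)
Definition pipe (n : nat) (D : 'M[tile]_n) (p : 'I_n) : {set 'I_n * 'I_n} :=
  [set c | [exists i : 'I_n, exists s : bool,
     (i.+1 == n) && connect (pipe_step D) (i, p, true) (c, s)]].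

Definition crossings (n : nat) (D : 'M[tile]_n) (p q : 'I_n) :
    {set 'I_n * 'I_n} :=
  [set c in pipe D p :&: pipe D q | D c.1 c.2 == Cross].

Definition is_reduced (n : nat) (D : 'M[tile]_n) : bool :=
  [forall p : 'I_n, forall q : 'I_n, (p != q) ==> (#|crossings D p q| <= 1)].

Definition reduced_bpds (n : nat) : {set 'M[tile]_n} :=
  [set D | is_bpd D & is_reduced D].

(* The arguments [a] (column) and [b] (row) are grid-point coordinates, from
   0 to [n]: the cells just above the grid line [b] are those of row index
   [b.-1], and there is none when [b = 0], so that [height D a 0 = 0]. *)
Definition height (n : nat) (D : 'M[tile]_n) (a b : nat) : nat :=
  #|[set j : 'I_n | (j < a) && [exists i : 'I_n, (i.+1 == b) && south (D i j)]]|.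

Definition around (n a b : nat) (i j : 'I_n) : bool :=
  ((i.+1 == b) || (i == b :> nat)) && ((j.+1 == a) || (j == a :> nat)).

Definition flip_at (n a b : nat) (D E : 'M[tile]_n) : bool :=
  [&& is_bpd E,
      [forall i : 'I_n, forall j : 'I_n, ~~ around a b i j ==> (E i j == D i j)],
      [forall a' : 'I_n.+1, forall b' : 'I_n.+1,
         ((a' : nat, b' : nat) != (a, b)) ==> (height E a' b' == height D a' b')]
    & (height E a b == (height D a b).+1) || (height D a b == (height E a b).+1)].

Definition flip (n : nat) (D E : 'M[tile]_n) : bool :=
  [exists a : 'I_n, exists b : 'I_n, [&& 0 < a, 0 < b & flip_at a b D E]].

Section Droop.
Variables (n : nat) (i1 i2 j1 j2 : 'I_n).

Definition in_rect (i j : 'I_n) : bool := (i1 <= i <= i2) && (j1 <= j <= j2).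

Definition corner (i j : 'I_n) : bool :=
  ((i == i1) || (i == i2)) && ((j == j1) || (j == j2)).

Definition no_noncorner_elbow (D : 'M[tile]_n) : bool :=
  [forall i : 'I_n, forall j : 'I_n,
     in_rect i j && ~~ corner i j ==> ~~ elbow (D i j)].

Definition droopable (D : 'M[tile]_n) : bool :=
  [&& D i1 j1 == RElbow, D i2 j2 == Empty & no_noncorner_elbow D].

Definition undroopable (D : 'M[tile]_n) : bool :=
  [&& D i1 j1 == Empty, D i2 j2 == JElbow, D i1 j2 == RElbow, D i2 j1 == RElbow
    & no_noncorner_elbow D].

(* The tiles that fall through in the four border rules below do not occur on
   the corresponding border of a droopable rectangle of a BPD. *)
Definition droop_north (t : tile) : tile :=
  match t with Horizontal => Empty | Cross => Vertical | _ => t end.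
Definition droop_west (t : tile) : tile :=
  match t with Vertical => Empty | Cross => Horizontal | _ => t end.
Definition droop_south (t : tile) : tile :=
  match t with Empty => Horizontal | Vertical => Cross | _ => t end.
Definition droop_east (t : tile) : tile :=
  match t with Empty => Vertical | Horizontal => Cross | _ => t end.

Definition droop_result (D : 'M[tile]_n) : 'M[tile]_n :=
  \matrix_(i, j)
    if ~~ in_rect i j then D i j
    else if (i == i1) && (j == j1) then Empty
    else if (i == i2) && (j == j2) then JElbow
    else if corner i j then RElbow
    else if i == i1 then droop_north (D i j)
    else if j == j1 then droop_west (D i j)
    else if i == i2 then droop_south (D i j)
    else if j == j2 then droop_east (D i j)
    else D i j.

Definition droop_at (D E : 'M[tile]_n) : bool :=
  droopable D && (E == droop_result D).

Definition undroop_at (D E : 'M[tile]_n) : bool :=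
  undroopable D && droop_at E D.

End Droop.

Definition droop (n : nat) (D E : 'M[tile]_n) : bool :=
  [exists i1 : 'I_n, exists i2 : 'I_n, exists j1 : 'I_n, exists j2 : 'I_n,
     [&& i1 < i2, j1 < j2 & droop_at i1 i2 j1 j2 D E]].

Definition undroop (n : nat) (D E : 'M[tile]_n) : bool :=
  [exists i1 : 'I_n, exists i2 : 'I_n, exists j1 : 'I_n, exists j2 : 'I_n,
     [&& i1 < i2, j1 < j2 & undroop_at i1 i2 j1 j2 D E]].

Definition bpd_move (n : nat) : rel 'M[tile]_n :=
  fun D E => [|| flip D E, droop D E | undroop D E].

(* The graph with vertex set [V] whose edges are the [e]-related pairs of
   elements of [V] is connected; in particular it is nonempty. *)
Definition graph_connected (T : finType) (V : {set T}) (e : rel T) : Prop :=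
  V != set0 /\
  {in V &, forall x y, connect [rel u v | [&& u \in V, v \in V & e u v]] x y}.

(* Main.v *)
Require Import Defs.
From mathcomp Require Import all_boot all_order all_algebra.
From mathcomp Require Import zify.

(** Every reduced BPD other than the BPD of the identity permutation admits a
    move to a reduced BPD that raises the height function, so every reduced BPD
    is connected to the identity one.

    If the BPD has a j-elbow, take one with no other j-elbow weakly northwest
    of it; its pipe runs north to an r-elbow and comes from an r-elbow to the
    west.  In the rectangle they span the northwest corner is empty, and an
    elbow inside would have to be an r-elbow whose pipe crosses the pipe of the
    j-elbow twice.  So an undroop applies; it moves the crosses of the south
    and east borders to the opposite borders and keeps the pairs of pipes that
    cross there.

    If there is no j-elbow, take a cross with no other cross weakly northwest
    of it.  The flip at the northwest corner of this cross resolves it, and in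
    the result no j-elbow lies below a cross in the same column, which forces
    reducedness.

    A BPD without j-elbows and crosses is the identity one. *)

Set Implicit Arguments.
Unset Strict Implicit.
Unset Printing Implicit Defensive.

(** * Pipes *)

(* Tilings are handled as total functions; their values outside the [n] x [n]
   grid are irrelevant. *)
Record tiling_bpd (n : nat) (T : nat -> nat -> tile) : Prop := TilingBpd {
  bpd_ew : forall i j, i < n -> j.+1 < n -> east (T i j) = west (T i j.+1);
  bpd_sn : forall i j, i.+1 < n -> j < n -> south (T i j) = north (T i.+1 j);
  bpd_n : forall j, j < n -> north (T 0 j) = false;
  bpd_w : forall i, i < n -> west (T i 0) = false;
  bpd_s : forall i j, i.+1 = n -> j < n -> south (T i j);
  bpd_e : forall i j, i < n -> j.+1 = n -> east (T i j) }.

(* [visits n T p i j s]: the pipe from column [p] enters the cell [(i, j)]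
   through its south edge if [s], through its west edge otherwise.  The column
   [j] may be [n], after the pipe has left the grid. *)
Inductive visits (n : nat) (T : nat -> nat -> tile) (p : nat) :
    nat -> nat -> bool -> Prop :=
| visits_start i : i.+1 = n -> visits n T p i p true
| visits_north i j s :
    exits_north (T i.+1 j) s -> visits n T p i.+1 j s -> visits n T p i j true
| visits_east i j s :
    exits_east (T i j) s -> visits n T p i j s -> visits n T p i j.+1 false.

Definition tiling_reduced (n : nat) (T : nat -> nat -> tile) : Prop :=
  forall p q i j i' j' s1 s2 s3 s4, p < n -> q < n -> p <> q ->
    T i j = Cross -> T i' j' = Cross -> j < n -> j' < n ->
    visits n T p i j s1 -> visits n T q i j s2 ->
    visits n T p i' j' s3 -> visits n T q i' j' s4 -> i = i' /\ j = j'.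

Section Visits.
Context (n : nat) (T : nat -> nat -> tile).

(** The last bound concerns the diagonal index [j - i]: it grows by one with each step of a pipe,
    starting from [p - (n - 1)]. *)
Lemma visits_bound p i j s :
  visits n T p i j s -> [&& i < n, p <= j & p + i < j + n].
Proof. elim=> {i j s} [i <-|i j s _ _|i j s _ _]; lia. Qed.

(** Each step raises [j - i] by one and the entry edge determines the exit, so a pipe has at most
    one state on each diagonal. *)
Lemma visits_diag_inj p i j s i' j' s' :
  visits n T p i j s -> visits n T p i' j' s' -> i + j' = i' + j ->
  [/\ i = i', j = j' & s = s'].
Proof.
move=> H; elim: H i' j' s' => {i j s} [i e|i j s ex H IH|i j s ex H IH] i' j' s' H'.
- case: H' => {i' j' s'} [i' e'|i' j' s' _ /visits_bound|i' j' s' _ /visits_bound];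
    by [split; lia|lia].
- case: H' => {i' j' s'} [i' e'|i' j' s' ex' H'|i' j' s' ex' H'] d.
  + by have := visits_bound H; lia.
  + by case: (IH _ _ _ H') => [|? -> _]; [lia|split=> //; lia].
  + case: (IH _ _ _ H') => [|ei ej es]; first lia.
    by move: ex ex'; rewrite ei ej es; case: (T _ _) s' {H' es} => -[].
- case: H' => {i' j' s'} [i' e'|i' j' s' ex' H'|i' j' s' ex' H'] d.
  + by have := visits_bound H; lia.
  + case: (IH _ _ _ H') => [|ei ej es]; first lia.
    by move: ex ex'; rewrite ei ej es; case: (T _ _) s' {H' es} => -[].
  + by case: (IH _ _ _ H') => [|? ? _]; [lia|split=> //; lia].
Qed.

(** The hypothesis on the diagonals says that [(i, j)] comes no earlier on the pipe than [(i', j')],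
    and pipes only go north and east. *)
Lemma visits_mono p i j s i' j' s' :
  visits n T p i j s -> visits n T p i' j' s' -> i + j' <= i' + j ->
  i <= i' /\ j' <= j.
Proof.
move=> H H'; elim: H => {i j s} [i e|i j s ex H IH|i j s ex H IH] d.
- by have := visits_bound H'; lia.
- have [e|ne] := eqVneq (i + j') (i' + j); last by lia.
  by case: (visits_diag_inj (visits_north ex H) H' e); lia.
- have [e|ne] := eqVneq (i + j') (i' + j.+1); last by lia.
  by case: (visits_diag_inj (visits_east ex H) H' e); lia.
Qed.

Lemma visits_inv p i j s : visits n T p i j s ->
  if s then (i.+1 = n /\ p = j) \/
            exists2 s', exits_north (T i.+1 j) s' & visits n T p i.+1 j s'
  else exists j' s', [/\ j = j'.+1, exits_east (T i j') s' & visits n T p i j' s'].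
Proof.
case=> {i j s} [i e|i j s ex H|i j s ex H]; first by left.
- by right; exists s.
- by exists j, s.
Qed.

Lemma exits_north_inj t s s' : exits_north t s -> exits_north t s' -> s = s'.
Proof. by case: t s s' => [] [] []. Qed.

Lemma exits_east_inj t s s' : exits_east t s -> exits_east t s' -> s = s'.
Proof. by case: t s s' => [] [] []. Qed.

(** Distinct entries of a tile have distinct exits, so a state can be traced back in only one
    way. *)
Lemma visits_start_inj p q i j s :
  visits n T p i j s -> visits n T q i j s -> p = q.
Proof.
move=> H; elim: H => {i j s} [i e|i j s ex H IH|i j s ex H IH] /visits_inv.
- by case=> [[_ ->]|[s _ /visits_bound]]; lia.
- case=> [[e _]|[s' ex' H']]; first by have := visits_bound H; lia.
  by apply: IH; rewrite (exits_north_inj ex ex').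
- case=> [j' [s' [[<-] ex' H']]].
  by apply: IH; rewrite (exits_east_inj ex ex').
Qed.

(** The segment is traced back west and south. It cannot come from the west boundary, so it ends on
    the south one; [j + (n - i)] decreases on the way. *)
Lemma visited i j s : tiling_bpd n T -> i < n -> j < n ->
  (if s then south (T i j) else west (T i j)) ->
  exists2 p, p < n & visits n T p i j s.
Proof.
move=> B; have [m] := ubnP (j + (n - i)).
elim: m i j s => // m IH i j [] lm li lj live.
- have [e|ne] := eqVneq i.+1 n; first by exists j => //; constructor.
  have li' : i.+1 < n by lia.
  rewrite (bpd_sn B) // in live.
  case E: (T i.+1 j) live => // _.
  + by have [||||p lp vp] := IH i.+1 j true; rewrite ?E //; try lia;
      exists p => //; apply: visits_north vp; rewrite E.
  + by have [||||p lp vp] := IH i.+1 j true; rewrite ?E //; try lia;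
      exists p => //; apply: visits_north vp; rewrite E.
  + by have [||||p lp vp] := IH i.+1 j false; rewrite ?E //; try lia;
      exists p => //; apply: visits_north vp; rewrite E.
- case: j lm lj live => [|j] lm lj; first by rewrite (bpd_w B).
  rewrite -(bpd_ew B) //.
  case E: (T i j) => // _.
  + by have [||||p lp vp] := IH i j false; rewrite ?E //; try lia;
      exists p => //; apply: visits_east vp; rewrite E.
  + by have [||||p lp vp] := IH i j false; rewrite ?E //; try lia;
      exists p => //; apply: visits_east vp; rewrite E.
  + by have [||||p lp vp] := IH i j true; rewrite ?E //; try lia;
      exists p => //; apply: visits_east vp; rewrite E.
Qed.

Lemma visits_up p i i' j : i <= i' ->
  (forall k, i < k -> k <= i' -> exits_north (T k j) true) ->
  visits n T p i' j true -> visits n T p i j true.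
Proof.
move=> /subnKC <-; elim: (i' - i) => [|d IH]; first by rewrite addn0.
move=> up v; apply: IH => [k lk lk'|]; first by apply: up => //; lia.
by move: v; rewrite addnS => v; apply: visits_north v; apply: up; lia.
Qed.

Lemma visits_right p i j j' : j <= j' ->
  (forall l, j <= l -> l < j' -> exits_east (T i l) false) ->
  visits n T p i j false -> visits n T p i j' false.
Proof.
move=> /subnKC <-; elim: (j' - j) => [|d IH]; first by rewrite addn0.
move=> rt v; rewrite addnS; apply: (@visits_east _ _ _ _ _ false).
  by apply: rt; lia.
by apply: IH => // l ? ?; apply: rt; lia.
Qed.

Lemma visits_down p i i' j : i <= i' -> i' < n ->
  (forall k, i < k -> k <= i' -> exits_north (T k j) true) ->
  visits n T p i j true -> visits n T p i' j true.
Proof.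
move=> /subnKC <-; elim: (i' - i) => [|d IH]; first by rewrite addn0.
rewrite addnS => lt up v.
have {IH v} v : visits n T p (i + d) j true.
  by apply: IH v => [|k ? ?]; [lia|apply: up; lia].
case: (visits_inv v) => [|[s ex v']]; first lia.
by rewrite (@exits_north_inj _ true s _ ex) //; apply: up; lia.
Qed.

(* The vertical segment below a cross then starts on the south boundary, so the
   pipe entering the cross from the south is the one from the same column. *)
Lemma reduced_of_no_jelbow_below_cross :
  (forall i i' j, i < i' -> i' < n -> j < n -> T i j = Cross -> T i' j != JElbow) ->
  tiling_reduced n T.
Proof.
move=> noJ.
have col p i j : j < n -> T i j = Cross -> visits n T p i j true -> p = j.
  move=> lj cij v.
  have bound := visits_bound v.
  have low d : i + d < n -> visits n T p (i + d) j true.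
    elim: d => [|d IH] ld; first by rewrite addn0.
    have {IH} /visits_inv [|[s ex H]] : visits n T p (i + d) j true by apply: IH; lia.
      by lia.
    have : T (i + d).+1 j != JElbow by apply: (noJ i) => //; lia.
    rewrite addnS; case: s ex H => //; by case: (T _ _).
  have /visits_inv[[]//|[s _ /visits_bound]] : visits n T p (i + (n.-1 - i)) j true.
    by apply: low; lia.
  by lia.
(* The pipe from the south starts in column [j], the largest start possible for a pipe reaching this
   cell. So it is [q], and [p] comes from the west. *)
have side p q i j s1 s2 : j < n -> T i j = Cross -> p < q ->
    visits n T p i j s1 -> visits n T q i j s2 -> q = j /\ s1 = false.
  move=> lj cij lt v1 v2; case: s1 v1 => v1; case: s2 v2 => v2.
  - by have := visits_start_inj v1 v2; lia.
  - by have := col _ _ _ lj cij v1; have := visits_bound v2; lia.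
  - by have := col _ _ _ lj cij v2.
  - by have := visits_start_inj v1 v2; lia.
(* After going straight east through a cross of column [j], a pipe never returns to that column. *)
have row p i i' j : T i' j = Cross -> visits n T p i j false ->
    visits n T p i' j false -> i' <= i.
  move=> cr v v'; rewrite leqNgt; apply/negP => lt.
  have {}v' : visits n T p i' j.+1 false by apply: visits_east v'; rewrite cr.
  by have := visits_mono v v'; lia.
have main p q i j i' j' s1 s2 s3 s4 : p < q -> T i j = Cross -> T i' j' = Cross ->
    j < n -> j' < n ->
    visits n T p i j s1 -> visits n T q i j s2 ->
    visits n T p i' j' s3 -> visits n T q i' j' s4 -> i = i' /\ j = j'.
  move=> lt c c' lj lj' v1 v2 v3 v4.
  have [e e1] := side _ _ _ _ _ _ lj c lt v1 v2.
  have [e' e3] := side _ _ _ _ _ _ lj' c' lt v3 v4; subst.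
  split=> //; apply/eqP; rewrite eqn_leq.
  by rewrite (row p _ _ _ c v3 v1) (row p _ _ _ c' v1 v3).
move=> p q i j i' j' s1 s2 s3 s4 lp lq /eqP; rewrite neq_ltn => /orP[] lt c c' lj lj' v1 v2 v3 v4.
  exact: main lt c c' lj lj' v1 v2 v3 v4.
exact: main lt c c' lj lj' v2 v1 v4 v3.
Qed.
End Visits.

(** * Raising the height on a rectangle *)

Definition toggled_code (n s e w : bool) (t : tile) :=
  (n (+) north t, s (+) south t, e (+) east t, w (+) west t).

(** The default [Empty] covers toggles that produce no tile; [raisable] excludes them. *)
Definition toggle (n s e w : bool) (t : tile) : tile :=
  odflt Empty (tile_decode (toggled_code n s e w t)).

Section Raise.
Context (i1 i2 j1 j2 : nat).

Variant rect_cell : nat -> nat -> Prop :=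
| cell_out i j of ~~ ((i1 <= i <= i2) && (j1 <= j <= j2)) : rect_cell i j
| cell_in i j of i1 < i < i2 & j1 < j < j2 : rect_cell i j
| cell_nw : rect_cell i1 j1
| cell_ne : rect_cell i1 j2
| cell_sw : rect_cell i2 j1
| cell_se : rect_cell i2 j2
| cell_n j of j1 < j < j2 : rect_cell i1 j
| cell_w i of i1 < i < i2 : rect_cell i j1
| cell_s j of j1 < j < j2 : rect_cell i2 j
| cell_e i of i1 < i < i2 : rect_cell i j2.

Lemma rect_cellP i j : rect_cell i j.
Proof.
have [h|] := boolP ((i1 <= i <= i2) && (j1 <= j <= j2)); last by constructor.
have [<-|ni1] := eqVneq i1 i; have [<-|nj1] := eqVneq j1 j; try by constructor.
- have [->|nj2] := eqVneq j j2; constructor; lia.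
- have [->|ni2] := eqVneq i i2; constructor; lia.
have [->|ni2] := eqVneq i i2; have [->|nj2] := eqVneq j j2; constructor; lia.
Qed.

(* All the edges met by the boundary of the rectangle of centres of the corner
   cells are toggled: this is both the undroop of the rectangle and, when
   [i2 = i1.+1] and [j2 = j1.+1], the height-increasing flip. *)
Definition raise (T : nat -> nat -> tile) (i j : nat) : tile :=
  toggle ((i1 < i <= i2) && ((j == j1) || (j == j2)))
         ((i1 <= i < i2) && ((j == j1) || (j == j2)))
         ((j1 <= j < j2) && ((i == i1) || (i == i2)))
         ((j1 < j <= j2) && ((i == i1) || (i == i2))) (T i j).

Definition raisable (T : nat -> nat -> tile) : Prop := forall i j,
  tile_code (raise T i j) =
  toggled_code ((i1 < i <= i2) && ((j == j1) || (j == j2)))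
               ((i1 <= i < i2) && ((j == j1) || (j == j2)))
               ((j1 <= j < j2) && ((i == i1) || (i == i2)))
               ((j1 < j <= j2) && ((i == i1) || (i == i2))) (T i j).

Lemma toggle0 t : toggle false false false false t = t.
Proof. by case: t. Qed.

Context (T : nat -> nat -> tile) (lti : i1 < i2) (ltj : j1 < j2).

Lemma raise_eq n s e w i j :
  (i1 < i <= i2) && ((j == j1) || (j == j2)) = n ->
  (i1 <= i < i2) && ((j == j1) || (j == j2)) = s ->
  (j1 <= j < j2) && ((i == i1) || (i == i2)) = e ->
  (j1 < j <= j2) && ((i == i1) || (i == i2)) = w ->
  raise T i j = toggle n s e w (T i j).
Proof. by rewrite /raise => -> -> -> ->. Qed.

Lemma raise_out i j : ~~ ((i1 <= i <= i2) && (j1 <= j <= j2)) ->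
  raise T i j = T i j.
Proof. by move=> h; rewrite (@raise_eq false false false false) ?toggle0 //; lia. Qed.

Lemma raise_in i j : i1 < i < i2 -> j1 < j < j2 -> raise T i j = T i j.
Proof. by move=> ? ?; rewrite (@raise_eq false false false false) ?toggle0 //; lia. Qed.

Lemma raise_nw : raise T i1 j1 = toggle false true true false (T i1 j1).
Proof. by apply: raise_eq; lia. Qed.

Lemma raise_ne : raise T i1 j2 = toggle false true false true (T i1 j2).
Proof. by apply: raise_eq; lia. Qed.

Lemma raise_sw : raise T i2 j1 = toggle true false true false (T i2 j1).
Proof. by apply: raise_eq; lia. Qed.

Lemma raise_se : raise T i2 j2 = toggle true false false true (T i2 j2).
Proof. by apply: raise_eq; lia. Qed.

Lemma raise_n j : j1 < j < j2 -> raise T i1 j = toggle false false true true (T i1 j).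
Proof. by move=> ?; apply: raise_eq; lia. Qed.

Lemma raise_w i : i1 < i < i2 -> raise T i j1 = toggle true true false false (T i j1).
Proof. by move=> ?; apply: raise_eq; lia. Qed.

Lemma raise_s j : j1 < j < j2 -> raise T i2 j = toggle false false true true (T i2 j).
Proof. by move=> ?; apply: raise_eq; lia. Qed.

Lemma raise_e i : i1 < i < i2 -> raise T i j2 = toggle true true false false (T i j2).
Proof. by move=> ?; apply: raise_eq; lia. Qed.

Hypothesis ok : raisable T.

Lemma raise_north i j : north (raise T i j) =
  (i1 < i <= i2) && ((j == j1) || (j == j2)) (+) north (T i j).
Proof. by case: (ok i j). Qed.

Lemma raise_south i j : south (raise T i j) =
  (i1 <= i < i2) && ((j == j1) || (j == j2)) (+) south (T i j).
Proof. by case: (ok i j). Qed.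

Lemma raise_east i j : east (raise T i j) =
  (j1 <= j < j2) && ((i == i1) || (i == i2)) (+) east (T i j).
Proof. by case: (ok i j). Qed.

Lemma raise_west i j : west (raise T i j) =
  (j1 < j <= j2) && ((i == i1) || (i == i2)) (+) west (T i j).
Proof. by case: (ok i j). Qed.

(** An edge is toggled alike in its two cells, and boundary edges are never toggled because the
    rectangle of centres does not meet them. *)
Lemma raise_bpd n : i2 < n -> j2 < n -> tiling_bpd n T -> tiling_bpd n (raise T).
Proof.
move=> li lj B; split=> [i j ? ?|i j ? ?|j ?|i ?|i j e ?|i j ? e].
- by rewrite raise_east raise_west (bpd_ew B) //; congr (_ && _ (+) _); lia.
- by rewrite raise_south raise_north (bpd_sn B) //; congr (_ && _ (+) _); lia.
- by rewrite raise_north (bpd_n B).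
- by rewrite raise_west (bpd_w B).
- by rewrite raise_south (bpd_s B) // addbT; lia.
- by rewrite raise_east (bpd_e B) // addbT; lia.
Qed.

Definition tiling_height (n : nat) (S : nat -> nat -> tile) (a b : nat) : nat :=
  \sum_(j < n) [&& j < a, 0 < b & south (S b.-1 j)].

Hypothesis swap : forall i, i1 <= i < i2 -> ~~ south (T i j1) && south (T i j2).

(** By [swap], on each grid line [b] with [i1 < b <= i2] one vertical segment moves from column [j2]
    to column [j1]. Only counts that include [j1] but not [j2] change. *)
Lemma raise_height n a b : j2 < n ->
  tiling_height n (raise T) a b =
  tiling_height n T a b + ((j1 < a <= j2) && (i1 < b <= i2)).
Proof.
move=> lj.
have one k (lk : k < n) (c : bool) : \sum_(j < n) ((j == k :> nat) && c : nat) = c.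
  rewrite (bigD1 (Ordinal lk)) //= eqxx big1 ?addn0 // => j.
  by rewrite -val_eqE /= => /negPf->.
(* [c k] is the contribution to the height of the moved segment when it lies in column [k]; the
   balance is stated additively to avoid subtraction. *)
pose c k := [&& k < a, 0 < b & i1 <= b.-1 < i2].
suff: tiling_height n (raise T) a b + c j2 = tiling_height n T a b + c j1.
  by rewrite /c; lia.
rewrite -(one j2 lj (c j2)) -(@one j1 _ (c j1)); last by lia.
rewrite -!big_split; apply: eq_bigr => j _ /=.
rewrite raise_south /c.
have [lb|lb] := boolP (i1 <= b.-1 < i2); last by rewrite /= !andbF.
have := swap lb.
have [->|] := eqVneq (j : nat) j1; last have [->|] := eqVneq (j : nat) j2.
- by have -> : (j1 == j2) = false by [lia]; case: south => //= _; lia.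
- by have -> : (j2 == j1) = false by [lia]; case: (south (T _ j2)); rewrite ?andbF //= => _; lia.
by rewrite /= => _ _ _; lia.
Qed.
End Raise.

(** * Undroops *)

Definition toggleable n s e w (t : tile) : bool :=
  isSome (tile_decode (toggled_code n s e w t)).

Lemma raisableP i1 i2 j1 j2 T : i1 < i2 -> j1 < j2 ->
  toggleable false true true false (T i1 j1) ->
  toggleable false true false true (T i1 j2) ->
  toggleable true false true false (T i2 j1) ->
  toggleable true false false true (T i2 j2) ->
  (forall j, j1 < j < j2 -> toggleable false false true true (T i1 j)
                         /\ toggleable false false true true (T i2 j)) ->
  (forall i, i1 < i < i2 -> toggleable true true false false (T i j1)
                         /\ toggleable true true false false (T i j2)) ->
  raisable i1 i2 j1 j2 T.
Proof.
move=> lti ltj nw ne sw se hor ver.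
have codeK n s e w t : toggleable n s e w t ->
    tile_code (toggle n s e w t) = toggled_code n s e w t.
  by case: n s e w t => [] [] [] [] [].
have H i j n s e w : toggleable n s e w (T i j) ->
  (i1 < i <= i2) && ((j == j1) || (j == j2)) = n ->
  (i1 <= i < i2) && ((j == j1) || (j == j2)) = s ->
  (j1 <= j < j2) && ((i == i1) || (i == i2)) = e ->
  (j1 < j <= j2) && ((i == i1) || (i == i2)) = w ->
  tile_code (raise i1 i2 j1 j2 T i j) =
  toggled_code ((i1 < i <= i2) && ((j == j1) || (j == j2)))
               ((i1 <= i < i2) && ((j == j1) || (j == j2)))
               ((j1 <= j < j2) && ((i == i1) || (i == i2)))
               ((j1 < j <= j2) && ((i == i1) || (i == i2))) (T i j).
  by move=> ok e1 e2 e3 e4; rewrite /raise e1 e2 e3 e4 codeK.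
have triv t : toggleable false false false false t by case: t.
move=> i j; case: (rect_cellP i1 i2 j1 j2 i j) => {i j} [i j b|i j b b'|||||j b|i b|j b|i b].
- by apply: (H _ _ _ _ _ _ (triv _)); lia.
- by apply: (H _ _ _ _ _ _ (triv _)); lia.
- by apply: (H _ _ _ _ _ _ nw); lia.
- by apply: (H _ _ _ _ _ _ ne); lia.
- by apply: (H _ _ _ _ _ _ sw); lia.
- by apply: (H _ _ _ _ _ _ se); lia.
- by case: (hor _ b) => h _; apply: (H _ _ _ _ _ _ h); lia.
- by case: (ver _ b) => h _; apply: (H _ _ _ _ _ _ h); lia.
- by case: (hor _ b) => _ h; apply: (H _ _ _ _ _ _ h); lia.
- by case: (ver _ b) => _ h; apply: (H _ _ _ _ _ _ h); lia.
Qed.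

(** The border tiles are listed explicitly, so that each toggle can be evaluated cell by cell
    without the BPD conditions. *)
Record undroop_rect (i1 i2 j1 j2 : nat) (T : nat -> nat -> tile) : Prop :=
  UndroopRect {
    undroop_nw : T i1 j1 = Empty;
    undroop_ne : T i1 j2 = RElbow;
    undroop_sw : T i2 j1 = RElbow;
    undroop_se : T i2 j2 = JElbow;
    undroop_n : forall j, j1 < j < j2 -> T i1 j \in [:: Empty; Vertical];
    undroop_s : forall j, j1 < j < j2 -> T i2 j \in [:: Horizontal; Cross];
    undroop_w : forall i, i1 < i < i2 -> T i j1 \in [:: Empty; Horizontal];
    undroop_e : forall i, i1 < i < i2 -> T i j2 \in [:: Vertical; Cross];
    undroop_in : forall i j, i1 < i < i2 -> j1 < j < j2 -> ~~ elbow (T i j) }.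

(* The undroop carries a cross on the south (resp. east) border to the
   opposite border; these are its old coordinates. *)
Definition undroop_old_row (i1 i2 j1 j2 i j : nat) : nat :=
  if (i == i1) && (j1 < j < j2) then i2 else i.
Definition undroop_old_col (i1 i2 j1 j2 i j : nat) : nat :=
  if (j == j1) && (i1 < i < i2) then j2 else j.

(** The north and west borders are sent to the south and east ones, so collisions could only involve
    cells already there, which the hypotheses exclude. *)
Lemma undroop_old_inj i1 i2 j1 j2 i j i' j' :
  ~~ ((i == i2) && (j1 <= j <= j2)) -> ~~ ((j == j2) && (i1 <= i <= i2)) ->
  ~~ ((i' == i2) && (j1 <= j' <= j2)) -> ~~ ((j' == j2) && (i1 <= i' <= i2)) ->
  undroop_old_row i1 i2 j1 j2 i j = undroop_old_row i1 i2 j1 j2 i' j' ->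
  undroop_old_col i1 i2 j1 j2 i j = undroop_old_col i1 i2 j1 j2 i' j' ->
  i = i' /\ j = j'.
Proof.
rewrite /undroop_old_row /undroop_old_col => h1 h2 h3 h4.
case: ifP => [/andP[/eqP ? b1]|_]; case: ifP => [/andP[/eqP ? b2]|_] e;
  case: ifP => [/andP[/eqP ? b3]|_]; case: ifP => [/andP[/eqP ? b4]|_] e';
  subst; try by split.

all: lia.
Qed.

Section Undroop.
Context (n : nat) (i1 i2 j1 j2 : nat) (T : nat -> nat -> tile).
Context (lti : i1 < i2) (ltj : j1 < j2) (li : i2 < n) (lj : j2 < n).
Hypothesis U : undroop_rect i1 i2 j1 j2 T.

Lemma undroop_raisable : raisable i1 i2 j1 j2 T.
Proof.
apply: raisableP => //.
- by rewrite (undroop_nw U).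
- by rewrite (undroop_ne U).
- by rewrite (undroop_sw U).
- by rewrite (undroop_se U).
- by move=> j b; move: (undroop_n U b) (undroop_s U b); case: (T i1 j); case: (T i2 j).
- by move=> i b; move: (undroop_w U b) (undroop_e U b); case: (T i j1); case: (T i j2).
Qed.

Lemma undroop_swap i : i1 <= i < i2 -> ~~ south (T i j1) && south (T i j2).
Proof.
rewrite leq_eqVlt => /andP[/orP[/eqP<-|l] l'].
  by rewrite (undroop_nw U) (undroop_ne U).
have b : i1 < i < i2 by rewrite l.
by move: (undroop_w U b) (undroop_e U b); case: (T i j1); case: (T i j2).
Qed.

Local Notation E := (raise i1 i2 j1 j2 T).

(** This lemma and the next describe the old course of the elbow pipe: east along the south border,
    then north from the j-elbow along the east border. *)
Lemma visits_undroop_south p j : j1 < j <= j2 ->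
  visits n T p i2 j1 true -> visits n T p i2 j false.
Proof.
move=> b v; apply: (@visits_right _ _ _ _ j1.+1) => [|l ? ?|]; first lia.
  by have /(undroop_s U) : j1 < l < j2; [lia|case: (T i2 l)].
by apply: visits_east v; rewrite (undroop_sw U).
Qed.

Lemma visits_undroop_east p i : i1 <= i < i2 ->
  visits n T p i2 j1 true -> visits n T p i j2 true.
Proof.
move=> b v; have {}v : visits n T p i2 j2 false by apply: visits_undroop_south v; lia.
apply: (@visits_up _ _ _ _ i2.-1); first lia.
  move=> k ? ?; have /(undroop_e U) : i1 < k < i2 by lia.
  by case: (T k j2).
apply: (@visits_north _ _ _ _ _ false); rewrite prednK //; try lia.
by rewrite (undroop_se U).
Qed.

(* The states of the elbow pipe on its new course, along the west and north
   borders. *)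
Definition undroop_new (i j : nat) (s : bool) : bool :=
  [&& s, i1 <= i < i2 & j == j1] || [&& ~~ s, i == i1 & j1 < j <= j2].

(** Off the new course a pipe makes the same step in both tilings. On it, only the identity of the
    elbow pipe is remembered, until that pipe rejoins its old course at the northeast corner. *)
Lemma visits_undroop p i j s : visits n E p i j s ->
  if undroop_new i j s then visits n T p i2 j1 true else visits n T p i j s.
Proof.
elim=> {i j s} [i e|i j s|i j s].
- by rewrite ifF ?e /undroop_new; [constructor|lia].
- have [k ek] : exists k, k = i.+1 by eexists.
  rewrite -ek => ex _ IH.
  have step t : T k j = t -> exits_north t s -> ~~ undroop_new k j s ->
      ~~ undroop_new i j true ->
      if undroop_new i j true then visits n T p i2 j1 true else visits n T p i j true.
    move=> e ex' o1 o2; rewrite (negPf o2) in IH *; rewrite (negPf o1) in IH.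
    by rewrite ek in e IH; apply: visits_north IH; rewrite e.
  move: ex step IH; case: (rect_cellP i1 i2 j1 j2 k j) ek => {k j} [k j b|k j b b'|||||j b|k b|j b|k b] ek.
  + rewrite raise_out // => ex step _; apply: step (erefl _) ex _ _; rewrite /undroop_new; lia.
  + rewrite raise_in // => ex step _; apply: step (erefl _) ex _ _; rewrite /undroop_new; lia.
  + by rewrite raise_nw // (undroop_nw U).
  + by rewrite raise_ne // (undroop_ne U).
  + rewrite raise_sw // (undroop_sw U); case: s => // _ _.
    by rewrite ifF ?ifT // /undroop_new; lia.
  + by rewrite raise_se // (undroop_se U).
  + rewrite raise_n // => ex step _; move: ex (undroop_n U b).
    case e : (T i1 j) => //; case: s step => // step _ _; apply: step e _ _ _ => //; rewrite /undroop_new; lia.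
  + rewrite raise_w // => ex _; move: ex (undroop_w U b).
    case e : (T k j1) => //; case: s => // _ _; rewrite !ifT // /undroop_new; lia.
  + rewrite raise_s // => ex step _; move: ex (undroop_s U b).
    case e : (T i2 j) => //; case: s step => // step _ _; apply: step e _ _ _ => //; rewrite /undroop_new; lia.
  + rewrite raise_e // => ex step _; move: ex (undroop_e U b).
    by case e : (T k j2) => //; case: s step.
- move=> ex _ IH.
  have step t : T i j = t -> exits_east t s -> ~~ undroop_new i j s ->
      ~~ undroop_new i j.+1 false ->
      if undroop_new i j.+1 false then visits n T p i2 j1 true else visits n T p i j.+1 false.
    move=> e ex' o1 o2; rewrite (negPf o2) in IH *; rewrite (negPf o1) in IH.
    by apply: visits_east IH; rewrite e.
  move: ex step IH; case: (rect_cellP i1 i2 j1 j2 i j) => {i j} [i j b|i j b b'|||||j b|i b|j b|i b].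
  + rewrite raise_out // => ex step _; apply: step (erefl _) ex _ _; rewrite /undroop_new; lia.
  + rewrite raise_in // => ex step _; apply: step (erefl _) ex _ _; rewrite /undroop_new; lia.
  + rewrite raise_nw // (undroop_nw U); case: s => // _ _.
    by rewrite !ifT // /undroop_new; lia.
  + rewrite raise_ne // (undroop_ne U); case: s => // _ _.
    rewrite ifT; last by rewrite /undroop_new; lia.
    rewrite ifF; last by rewrite /undroop_new; lia.
    move=> v; apply: (@visits_east _ _ _ _ _ true); first by rewrite (undroop_ne U).
    by apply: visits_undroop_east v; lia.
  + by rewrite raise_sw // (undroop_sw U).
  + by rewrite raise_se // (undroop_se U).
  + rewrite raise_n // => ex _; move: ex (undroop_n U b).
    case e : (T i1 j) => //; case: s => // _ _; rewrite !ifT // /undroop_new; lia.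
  + rewrite raise_w // => ex step _; move: ex (undroop_w U b).
    case e : (T i j1) => //; case: s step => // step _ _; apply: step e _ _ _ => //; rewrite /undroop_new; lia.
  + rewrite raise_s // => ex step _; move: ex (undroop_s U b).
    by case e : (T i2 j) => //; case: s step.
  + rewrite raise_e // => ex step _; move: ex (undroop_e U b).
    case e : (T i j2) => //; case: s step => // step _ _; apply: step e _ _ _ => //; rewrite /undroop_new; lia.
Qed.

Hypothesis B : tiling_bpd n T.

(** No elbow inside the rectangle interrupts the segment, so it runs straight down to the south
    border. *)
Lemma undroop_col j k : j1 < j < j2 -> T i1 j = Vertical -> i1 < k <= i2 ->
  T k j \in [:: Vertical; Cross].
Proof.
move=> b e1; elim: k => // k IH bk.
have : south (T k j).
  have [->|nk] := eqVneq k i1; first by rewrite e1.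
  by have /IH : i1 < k <= i2 by [lia]; case: (T k j).
rewrite (bpd_sn B); try lia.
have [->|nk] := eqVneq k.+1 i2; first by move: (undroop_s U b); case: (T i2 j).
have /(undroop_in U) /(_ b) : i1 < k.+1 < i2 by lia.
by case: (T k.+1 j).
Qed.

Lemma undroop_row i l : i1 < i < i2 -> T i j1 = Horizontal -> j1 < l <= j2 ->
  T i l \in [:: Horizontal; Cross].
Proof.
move=> b e1; elim: l => // l IH bl.
have : east (T i l).
  have [->|nl] := eqVneq l j1; first by rewrite e1.
  by have /IH : j1 < l <= j2 by [lia]; case: (T i l).
rewrite (bpd_ew B); try lia.
have [->|nl] := eqVneq l.+1 j2; first by move: (undroop_e U b); case: (T i j2).
have /(undroop_in U b) : j1 < l.+1 < j2 by lia.
by case: (T i l.+1).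
Qed.

Local Notation old_i := (undroop_old_row i1 i2 j1 j2).
Local Notation old_j := (undroop_old_col i1 i2 j1 j2).

Lemma undroop_cross i j : E i j = Cross ->
  ~~ ((i == i2) && (j1 <= j <= j2)) /\ ~~ ((j == j2) && (i1 <= i <= i2)).
Proof.
case: (rect_cellP i1 i2 j1 j2 i j) => {i j} [i j b|i j b b'|||||j b|i b|j b|i b].
- by rewrite raise_out //; lia.
- by lia.
- by lia.
- by rewrite raise_ne // (undroop_ne U).
- by rewrite raise_sw // (undroop_sw U).
- by rewrite raise_se // (undroop_se U).
- by lia.
- by lia.
- by rewrite raise_s //; move: (undroop_s U b); case: (T i2 j).
- by rewrite raise_e //; move: (undroop_e U b); case: (T i j2).
Qed.

(** A new cross on the north (west) border arises where the elbow pipe now meets a straight pipe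
    that traverses the rectangle. In [T] these two pipes cross on the opposite border. *)
Lemma visits_undroop_cross p i j s : E i j = Cross -> visits n E p i j s ->
  T (old_i i j) (old_j i j) = Cross /\
  exists s', visits n T p (old_i i j) (old_j i j) s'.
Proof.
move=> c v; have {v} := visits_undroop v; move: c; rewrite /undroop_old_row /undroop_old_col /undroop_new.
case: (rect_cellP i1 i2 j1 j2 i j) => {i j} [i j b|i j b b'|||||j b|i b|j b|i b].
- by rewrite raise_out // !ifF; try lia; move=> -> v; split=> //; exists s.
- by rewrite raise_in // !ifF; try lia; move=> -> v; split=> //; exists s.
- by rewrite raise_nw // (undroop_nw U).
- by rewrite raise_ne // (undroop_ne U).
- by rewrite raise_sw // (undroop_sw U).
- by rewrite raise_se // (undroop_se U).
- rewrite raise_n // [if (i1 == i1) && _ then _ else _]ifT; last lia.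
  rewrite [if (j == j1) && _ then _ else _]ifF; last lia.
  move=> c; have e1 : T i1 j = Vertical.
    by move: (undroop_n U b) c; case: (T i1 j).
  have cr : T i2 j = Cross.
    have /(undroop_col b e1) : i1 < i2 <= i2 by lia.
    by move: (undroop_s U b); case: (T i2 j).
  (* Entering from the west is the elbow pipe, formerly on the south border. Entering from the south
     is the straight pipe, traced back down to that border. *)
  move=> H; split=> //; case: s c H => _; last first.
    rewrite ifT; last lia.
    by move=> v; exists false; apply: visits_undroop_south v; lia.
  rewrite ifF; last lia.
  move=> v; exists true; apply: visits_down v => //; first lia.
  move=> k ? ?; have /(undroop_col b e1) : i1 < k <= i2 by lia.
  by case: (T k j).
- rewrite raise_w // [if (i == i1) && _ then _ else _]ifF; last lia.
  rewrite [if (j1 == j1) && _ then _ else _]ifT; last lia.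
  move=> c; have e1 : T i j1 = Horizontal.
    by move: (undroop_w U b) c; case: (T i j1).
  have cr : T i j2 = Cross.
    have /(undroop_row b e1) : j1 < j2 <= j2 by lia.
    by move: (undroop_e U b); case: (T i j2).
  (* Here the elbow pipe enters from the south, and the straight pipe from the west is followed to
     the east border. *)
  move=> H; split=> //; case: s c H => _.
    rewrite ifT; last lia.
    by move=> v; exists true; apply: visits_undroop_east v; lia.
  rewrite ifF; last lia.
  move=> v; exists false; apply: visits_right v => [|l ? ?]; first lia.
  have [->|nl] := eqVneq l j1; first by rewrite e1.
  have /(undroop_row b e1) : j1 < l <= j2 by lia.
  by case: (T i l).
- by rewrite raise_s //; move: (undroop_s U b); case: (T i2 j).
- by rewrite raise_e //; move: (undroop_e U b); case: (T i j2).
Qed.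

(** Passing to old coordinates maps the crossings of two pipes in [E] injectively to their crossings
    in [T]. *)
Lemma undroop_reduced : tiling_reduced n T -> tiling_reduced n E.
Proof.
move=> R p q i j i' j' s1 s2 s3 s4 lp lq npq c c' jn jn' v1 v2 v3 v4.
have [x [t1 w1]] := visits_undroop_cross c v1.
have [_ [t2 w2]] := visits_undroop_cross c v2.
have [x' [t3 w3]] := visits_undroop_cross c' v3.
have [_ [t4 w4]] := visits_undroop_cross c' v4.
have lt k l : l < n -> old_j k l < n by rewrite /undroop_old_col; case: ifP.
have [] := R _ _ _ _ _ _ _ _ _ _ lp lq npq x x' (lt _ _ jn) (lt _ _ jn') w1 w2 w3 w4.
by case: (undroop_cross c) (undroop_cross c') => ? ? []; apply: undroop_old_inj.
Qed.
End Undroop.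

(** Descent on [i + j]: a cell weakly northwest of [(i, j)] with the same coordinate sum is [(i, j)]
    itself. *)
Lemma exists_nw_minimal (P : nat -> nat -> bool) i j : P i j ->
  exists i' j', [/\ P i' j', i' <= i, j' <= j &
    forall k l, k <= i' -> l <= j' -> P k l -> k = i' /\ l = j'].
Proof.
have [m] := ubnP (i + j); elim: m i j => // m IH i j lm pij.
have [/existsP[k /existsP[l /andP[ne pkl]]]|none] :=
    boolP [exists k : 'I_i.+1, exists l : 'I_j.+1, (k + l != i + j) && P k l].
- have [] := IH k l _ pkl; first by have := ltn_ord k; have := ltn_ord l; lia.
  move=> i' [j' [p' li' lj' m']]; exists i', j'; split=> //.
    by have := ltn_ord k; lia.
  by have := ltn_ord l; lia.
- exists i, j; split=> // k l lk ll pkl.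
  have [|ne] := eqVneq (k + l) (i + j); first by lia.
  case/negP: none; apply/existsP; exists (Ordinal (lk : k < i.+1)).
  by apply/existsP; exists (Ordinal (ll : l < j.+1)); rewrite ne.
Qed.

(** * The rectangle of a northwest-minimal j-elbow *)

Section FindRect.
Context (n : nat) (T : nat -> nat -> tile) (B : tiling_bpd n T).

(** A segment followed north cannot reach the boundary, and an r-elbow is where it turns.
    [relbow_left] is the same argument going west. *)
Lemma relbow_above i j : i < n -> j < n -> north (T i j) ->
  (forall k, k < i -> T k j != JElbow) ->
  exists i', [/\ i' < i, T i' j = RElbow &
    forall k, i' < k < i -> T k j \in [:: Vertical; Cross]].
Proof.
elim: i => [|i IH] li lj nij noJ; first by rewrite (bpd_n B) in nij.
rewrite -(bpd_sn B) // in nij.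
have [e|ne] := eqVneq (T i j) RElbow; first by exists i; split=> // k; lia.
have nJ := noJ i (leqnn _).
have [||||i' [lt' e st]] := IH; try lia; try by move=> *; apply: noJ; lia.
  by move: nij ne nJ; case: (T i j).
exists i'; split=> // [|k]; first lia.
have [-> _|nk b] := eqVneq k i; last by apply: st; lia.
by move: nij ne nJ; case: (T i j).
Qed.

Lemma relbow_left i j : i < n -> j < n -> west (T i j) ->
  (forall l, l < j -> T i l != JElbow) ->
  exists j', [/\ j' < j, T i j' = RElbow &
    forall l, j' < l < j -> T i l \in [:: Horizontal; Cross]].
Proof.
elim: j => [|j IH] li lj wij noJ; first by rewrite (bpd_w B) in wij.
rewrite -(bpd_ew B) // in wij.
have [e|ne] := eqVneq (T i j) RElbow; first by exists j; split=> // k; lia.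
have nJ := noJ j (leqnn _).
have [||||j' [lt' e st]] := IH; try lia; try by move=> *; apply: noJ; lia.
  by move: wij ne nJ; case: (T i j).
exists j'; split=> // [|k]; first lia.
have [-> _|nk b] := eqVneq k j; last by apply: st; lia.
by move: wij ne nJ; case: (T i j).
Qed.

(** An r-elbow has no west edge, and a tile with no east edge that is not a j-elbow has no west edge
    either, so absence propagates to the left. *)
Lemma empty_left i j k : i < n -> j < n -> T i j = RElbow ->
  (forall l, l < j -> T i l != JElbow) -> k < j ->
  T i k \in [:: Empty; Vertical].
Proof.
move=> li lj e noJ; have [m] := ubnP (j - k); elim: m k => // m IH k lm lk.
have : east (T i k) = false.
  rewrite (bpd_ew B) //; last lia.
  have [->|ne] := eqVneq k.+1 j; first by rewrite e.
  have: T i k.+1 \in [:: Empty; Vertical] by apply: IH; lia.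
  by case: (T i k.+1).
by have := noJ k lk; case: (T i k).
Qed.

Lemma empty_above i j k : i < n -> j < n -> T i j = RElbow ->
  (forall l, l < i -> T l j != JElbow) -> k < i ->
  T k j \in [:: Empty; Horizontal].
Proof.
move=> li lj e noJ; have [m] := ubnP (i - k); elim: m k => // m IH k lm lk.
have : south (T k j) = false.
  rewrite (bpd_sn B) //; last lia.
  have [->|ne] := eqVneq k.+1 i; first by rewrite e.
  have: T k.+1 j \in [:: Empty; Horizontal] by apply: IH; lia.
  by case: (T k.+1 j).
by have := noJ k lk; case: (T k j).
Qed.

Lemma exists_undroop_rect i2 j2 : tiling_reduced n T -> i2 < n -> j2 < n ->
  T i2 j2 = JElbow ->
  (forall k l, k <= i2 -> l <= j2 -> T k l == JElbow -> k = i2 /\ l = j2) ->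
  exists i1 j1, [/\ i1 < i2, j1 < j2 & undroop_rect i1 i2 j1 j2 T].
Proof.
move=> R li lj eJ noJ.
have noJ' k l : k <= i2 -> l <= j2 -> (k < i2) || (l < j2) -> T k l != JElbow.
  by move=> lk ll ne; apply/negP => /(noJ _ _ lk ll); lia.
have [|k lk|i1 [lti ne eE]] := @relbow_above i2 j2 li lj; rewrite ?eJ //.
  by apply: noJ'; lia.
have [|l ll|j1 [ltj sw eS]] := @relbow_left i2 j2 li lj; rewrite ?eJ //.
  by apply: noJ'; lia.
exists i1, j1; split=> //.
have N j : j < j2 -> T i1 j \in [:: Empty; Vertical].
  apply: empty_left => //; first lia.
  by move=> l ll; apply: noJ'; lia.
have W i : i < i2 -> T i j1 \in [:: Empty; Horizontal].
  apply: empty_above => //; first lia.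
  by move=> l ll; apply: noJ'; lia.
split=> // [|j b|i b|i j bi bj].
(* [Empty] is the only tile allowed by both constraints on the northwest corner. *)
- by move: (N j1 ltj) (W i1 lti); case: (T i1 j1).
- by apply: N; lia.
- by apply: W; lia.
(* The pipe of an elbow inside would cross the elbow pipe twice: on the south
   and on the east border. *)
have nJ : T i j != JElbow by apply: noJ'; lia.
rewrite /elbow negb_or nJ andbT; apply/negP => /eqP eR.
have col k : i < k <= i2 -> T k j \in [:: Vertical; Cross].
  elim: k => // k IH bk.
  have : south (T k j).
    have [->|nk] := eqVneq k i; first by rewrite eR.
    by have /IH : i < k <= i2 by [lia]; case: (T k j).
  rewrite (bpd_sn B); try lia.
  have : T k.+1 j != JElbow by apply: noJ'; lia.
  by case: (T k.+1 j).
have row l : j < l <= j2 -> T i l \in [:: Horizontal; Cross].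
  elim: l => // l IH bl.
  have : east (T i l).
    have [->|nl] := eqVneq l j; first by rewrite eR.
    by have /IH : j < l <= j2 by [lia]; case: (T i l).
  rewrite (bpd_ew B); try lia.
  have : T i l.+1 != JElbow by apply: noJ'; lia.
  by case: (T i l.+1).
have cs : T i2 j = Cross.
  have /col : i < i2 <= i2 by lia.
  by have := eS _ bj; case: (T i2 j).
have ce : T i j2 = Cross.
  have /row : j < j2 <= j2 by lia.
  by have := eE _ bi; case: (T i j2).
(* At the cross on the south border, [p] enters from below and will turn at the inner r-elbow, while
   [q] is the pipe of the j-elbow. *)
have [||p lp vp] := @visited n T i2 j true B li; rewrite ?cs //; first lia.
have [||q lq vq] := @visited n T i2 j false B li; rewrite ?cs //; first lia.
have vp' : visits n T p i j2 false.
  apply: (@visits_right _ _ _ _ j.+1) => [|l ? ?|]; first lia.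
    by have /row : j < l <= j2 by [lia]; case: (T i l).
  apply: (@visits_east _ _ _ _ _ true); first by rewrite eR.
  apply: visits_up vp; first lia.
  by move=> k ? ?; have /col : i < k <= i2 by [lia]; case: (T k j).
have vq' : visits n T q i j2 true.
  apply: (@visits_up _ _ _ _ i2.-1); first lia.
    by move=> k ? ?; have /eE : i1 < k < i2 by [lia]; case: (T k j2).
  apply: (@visits_north _ _ _ _ _ false); rewrite prednK //; try lia.
    by rewrite eJ.
  apply: visits_right vq; first lia.
  move=> l ? ?; have /eS : j1 < l < j2 by lia.
  by case: (T i2 l).
have npq : p <> q.
  move=> e; rewrite e in vp.
  by have [] := visits_diag_inj vp vq (erefl _).
have ljj : j < n by lia.
by have := R _ _ _ _ _ _ _ _ _ _ lp lq npq cs ce ljj lj vp vq vp' vq'; lia.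
Qed.
End FindRect.

(** * Flips at a cross and the identity *)

Section FlipCross.
Context (n : nat) (T : nat -> nat -> tile) (B : tiling_bpd n T).
Hypothesis noJ : forall i j, i < n -> j < n -> T i j != JElbow.
Context (i j : nat) (li : i.+1 < n) (lj : j.+1 < n).
Hypothesis cr : T i.+1 j.+1 = Cross.
Hypothesis noC : forall k l, k <= i.+1 -> l <= j.+1 -> T k l == Cross ->
  k = i.+1 /\ l = j.+1.

(** The tiles above and to the left of the cross are joined to it and, by minimality, are not
    crosses. They therefore leave the northwest cell without east and south edges. *)
Lemma flip_cross_corners :
  [/\ T i j = Empty, T i j.+1 \in [:: Vertical; RElbow]
    & T i.+1 j \in [:: Horizontal; RElbow]].
Proof.
have noC' k l : k <= i.+1 -> l <= j.+1 -> (k <= i) || (l <= j) -> T k l != Cross.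
  by move=> lk ll ne; apply/negP => /(noC lk ll); lia.
have ne : T i j.+1 \in [:: Vertical; RElbow].
  have : south (T i j.+1) by rewrite (bpd_sn B) ?cr //; lia.
  have : T i j.+1 != Cross by apply: noC'; lia.
  by case: (T i j.+1).
have sw : T i.+1 j \in [:: Horizontal; RElbow].
  have : east (T i.+1 j) by rewrite (bpd_ew B) ?cr //; lia.
  have : T i.+1 j != Cross by apply: noC'; lia.
  by case: (T i.+1 j).
split=> //.
have : south (T i j) = false.
  by rewrite (bpd_sn B); [move: sw; case: (T i.+1 j)|lia|lia].
have : east (T i j) = false.
  by rewrite (bpd_ew B); [move: ne; case: (T i j.+1)|lia|lia].
by have : T i j != JElbow; [apply: noJ; lia|case: (T i j)].
Qed.

Local Notation E := (raise i i.+1 j j.+1 T).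

Lemma flip_cross_raisable : raisable i i.+1 j j.+1 T.
Proof.
have [nw ne sw] := flip_cross_corners.
apply: raisableP => //; rewrite ?nw ?cr //; try by move=> k; lia.
  by move: ne; case: (T i j.+1).
by move: sw; case: (T i.+1 j).
Qed.

Lemma flip_cross_swap k : i <= k < i.+1 -> ~~ south (T k j) && south (T k j.+1).
Proof.
rewrite ltnS => b; have -> : k = i by lia.
by have [-> + _] := flip_cross_corners; case: (T i j.+1).
Qed.

(** All j-elbows of the result lie in the flipped block, and a cross above one of them would be a
    cross of [T] contradicting minimality. *)
Lemma flip_cross_reduced : tiling_reduced n E.
Proof.
have [nw ne sw] := flip_cross_corners.
have li' := ltnW li; have lj' := ltnW lj.
have crossE k l : E k l = Cross ->
    T k l = Cross /\ ~~ ((i <= k <= i.+1) && (j <= l <= j.+1)).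
  case: (rect_cellP i i.+1 j j.+1 k l) => {k l} [k l b|k l b b'|||||l b|k b|l b|k b]; try lia.
  - by rewrite raise_out.
  - by rewrite raise_nw // nw.
  - by rewrite raise_ne //; move: ne; case: (T i j.+1).
  - by rewrite raise_sw //; move: sw; case: (T i.+1 j).
  - by rewrite raise_se // cr.
have jE k l : k < n -> l < n -> E k l = JElbow -> (k <= i.+1) && (l <= j.+1).
  case: (rect_cellP i i.+1 j j.+1 k l) => {k l} [k l b|k l b b'|||||l b|k b|l b|k b]; try lia.
  by rewrite raise_out // => lk ll e; have := noJ lk ll; rewrite e.
apply: reduced_of_no_jelbow_below_cross => k k' l lk lk' ll /crossE[c out].
apply/negP => /eqP /(jE _ _ lk' ll) b.
by have := @noC k l _ _; rewrite c eqxx => h; have [||//|] := h; lia.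
Qed.
End FlipCross.

Definition identity_tiling (i j : nat) : tile :=
  if i == j then RElbow else if i < j then Horizontal else Vertical.

Section Identity.
Context (n : nat).

Lemma identity_edges i j :
  tile_code (identity_tiling i j) = (j < i, j <= i, i <= j, i < j).
Proof. by rewrite /identity_tiling; case: ltngtP. Qed.

Lemma identity_bpd : tiling_bpd n identity_tiling.
Proof.
split=> [i j ? ?|i j ? ?|j ?|i ?|i j e ?|i j ? e].
- by case: (identity_edges i j) (identity_edges i j.+1) => _ _ -> _ [_ _ _ ->].
- by case: (identity_edges i j) (identity_edges i.+1 j) => _ -> _ _ [-> _ _ _].
- by case: (identity_edges 0 j) => ->.
- by case: (identity_edges i 0) => _ _ _ ->.
- by case: (identity_edges i j) => _ -> _ _; lia.
- by case: (identity_edges i j) => _ _ -> _; lia.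
Qed.

Lemma identity_reduced : tiling_reduced n identity_tiling.
Proof.
move=> p q i j i' j' s1 s2 s3 s4 _ _ _.
by rewrite /identity_tiling; case: ltngtP.
Qed.

(** Each row has an r-elbow, followed by horizontals to its right and verticals below it. The elbow
    columns then increase strictly with the row, which puts the elbows on the diagonal. *)
Lemma identity_tilingP (T : nat -> nat -> tile) : tiling_bpd n T ->
  (forall i j, i < n -> j < n -> (T i j != JElbow) && (T i j != Cross)) ->
  forall i j, i < n -> j < n -> T i j = identity_tiling i j.
Proof.
move=> B no.
have right i j l : i < n -> l < n -> T i j = RElbow -> j < l -> T i l = Horizontal.
  move=> li + e; elim: l => // l IH ll lt.
  have : east (T i l).
    have [->|ne] := eqVneq l j; first by rewrite e.
    by rewrite IH //; lia.
  by rewrite (bpd_ew B) //; have := no _ _ li ll; case: (T i l.+1).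
have below i j k : k < n -> j < n -> T i j = RElbow -> i < k -> T k j = Vertical.
  move=> + lj e; elim: k => // k IH lk lt.
  have : south (T k j).
    have [->|ne] := eqVneq k i; first by rewrite e.
    by rewrite IH //; lia.
  by rewrite (bpd_sn B) //; have := no _ _ lk lj; case: (T k.+1 j).
have elbow_row i : i < n -> exists2 j, j < n & T i j = RElbow.
  move=> li; have lj : n.-1 < n by lia.
  have : east (T i n.-1) by apply: (bpd_e B) => //; lia.
  elim: (n.-1) lj => [|j IH] lj ea.
    exists 0 => //; have := bpd_w B li; have := no _ _ li lj.
    by move: ea; case: (T i 0).
  have [e|ne] := eqVneq (T i j.+1) RElbow; first by exists j.+1.
  apply: IH; rewrite ?(bpd_ew B) //; first lia.
  by have := no _ _ li lj; move: ea ne; case: (T i j.+1).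
(* Otherwise the cell [(i', j)] would be vertical, lying below the upper elbow, and also an r-elbow
   or a horizontal because of the lower one. *)
have incr i i' j j' : i' < n -> j < n -> j' < n -> T i j = RElbow ->
    T i' j' = RElbow -> i < i' -> j < j'.
  move=> li' lj lj' e e' lt; rewrite ltnNge leq_eqVlt; apply/negP => /orP[/eqP ej|lt'].
    by have := below _ _ _ li' lj e lt; rewrite -ej e'.
  by have := right _ _ _ li' lj e' lt'; rewrite (below _ _ _ li' lj e lt).
(* Counting elbow rows from the top gives [i <= j]; counting the [d = n - i] rows from [i] to the
   bottom gives [j <= i]. *)
have ge i j : i < n -> j < n -> T i j = RElbow -> i <= j.
  elim: i j => // i IH j li lj e.
  have [|j' lj' e'] := elbow_row i; first lia.
  have := IH j' _ lj' e'; have := incr _ _ _ _ li lj' lj e' e (leqnn _); lia.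
have le d i j : i + d = n -> j < n -> T i j = RElbow -> j + d <= n.
  elim: d i j => [|d IH] i j ed lj e; first lia.
  case: d IH ed => [|d] IH ed; first lia.
  have [|j' lj' e'] := elbow_row i.+1; first lia.
  have li : i.+1 < n by lia.
  have := IH i.+1 j' _ lj' e'; have := incr _ _ _ _ li lj lj' e e' (leqnn _); lia.
have diag i : i < n -> T i i = RElbow.
  move=> li; have [j lj e] := elbow_row i li.
  suff ij : i = j by rewrite {2}ij.
  have := ge _ _ li lj e; have := le (n - i) i j _ lj e; lia.
move=> i j li lj; rewrite /identity_tiling.
case: ifP => [/eqP<-|ne]; first exact: diag.
case: ifP => lt; first by apply: right (diag _ li) _.
by apply: below (diag _ lj) _ => //; lia.
Qed.
End Identity.

(** * Matrices of tiles *)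

Section Entries.
Context (n : nat).
Implicit Types (D : 'M[tile]_n) (T : nat -> nat -> tile).

Definition entry D (i j : nat) : tile :=
  if insub i is Some i' then if insub j is Some j' then D i' j' else Empty
  else Empty.

Definition agree D T : Prop := forall i j : 'I_n, D i j = T i j.

Lemma entry_agree D : agree D (entry D).
Proof. by move=> i j; rewrite /entry !valK. Qed.

Lemma agree_mx T : agree (\matrix_(i, j) T i j)%R T.
Proof. by move=> i j; rewrite mxE. Qed.

Lemma is_bpdP D T : agree D T -> reflect (tiling_bpd n T) (is_bpd D).
Proof.
move=> a; apply: (iffP idP) => [/andP[ew /and5P[sn no we so ea]]|[ew sn no we so ea]].
- split=> [i j li lj|i j li lj|j lj|i li|i j ei lj|i j li ej].
  + move: ew => /forallP/(_ (Ordinal li))/forallP/(_ (Ordinal (ltnW lj))).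
    by move=> /forallP/(_ (Ordinal lj)); rewrite !a /= eqxx => /eqP.
  + move: sn => /forallP/(_ (Ordinal (ltnW li)))/forallP/(_ (Ordinal li)).
    by move=> /forallP/(_ (Ordinal lj)); rewrite !a /= eqxx => /eqP.
  + have l0 : 0 < n by lia.
    move: no => /forallP/(_ (Ordinal l0))/forallP/(_ (Ordinal lj)).
    by rewrite !a /= => /negbTE.
  + have l0 : 0 < n by lia.
    move: we => /forallP/(_ (Ordinal li))/forallP/(_ (Ordinal l0)).
    by rewrite !a /= => /negbTE.
  + have li : i < n by lia.
    move: so => /forallP/(_ (Ordinal li))/forallP/(_ (Ordinal lj)).
    by rewrite !a /= ei eqxx.
  + have lj : j < n by lia.
    move: ea => /forallP/(_ (Ordinal li))/forallP/(_ (Ordinal lj)).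
    by rewrite !a /= ej eqxx.
- apply/andP; split; last (apply/and5P; split); apply/forallP => i; apply/forallP => j.
  + apply/forallP => j'; apply/implyP => /eqP e.
    by rewrite !a e ew // -e.
  + apply/forallP => k; apply/implyP => /eqP e.
    by rewrite !a e sn // -e.
  + by apply/implyP => /eqP e; rewrite a e no.
  + by apply/implyP => /eqP e; rewrite a e we.
  + by apply/implyP => /eqP e; rewrite a so.
  + by apply/implyP => /eqP e; rewrite a ea.
Qed.

Lemma mem_pipeP D T (p i j : 'I_n) : agree D T ->
  reflect (exists s, visits n T p i j s) ((i, j) \in pipe D p).
Proof.
move=> a; rewrite inE; apply: (iffP existsP).
- case=> k /existsP[s /andP[/eqP ek /connectP[w]]].
  pose vis (x : 'I_n * 'I_n * bool) := visits n T p x.1.1 x.1.2 x.2.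
  have step x y : pipe_step D x y -> vis x -> vis y.
    case: x y => [[k1 l1] s1] [[k2 l2] []] /= /and3P[]; rewrite a.
    + by move=> ex /eqP e /eqP->; rewrite /vis /= e in ex *; exact: visits_north.
    + by move=> ex /eqP-> /eqP e; rewrite /vis /= e; exact: visits_east.
  have path_vis x : vis x -> path (pipe_step D) x w -> vis (last x w).
    elim: w x => //= y w IH x vx /andP[xy]; apply: IH; exact: step xy vx.
  move=> pw e; exists s.
  have := path_vis _ _ pw; rewrite -e; apply.
  exact: visits_start.
- case=> s v.
  suff [k ek ck] : exists2 k : 'I_n, k.+1 = n & connect (pipe_step D) (k, p, true) (i, j, s).
    by exists k; apply/existsP; exists s; rewrite ek eqxx.
  move: v; move: {-2}(i : nat) (erefl (i : nat)) {-2}(j : nat) (erefl (j : nat)).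
  move=> i' ei j' ej v; elim: v i j ei ej => {i' j' s} [i ei|i j s ex v IH|i j s ex v IH] i' j' eqi eqj.
  + exists i'; first by rewrite -eqi.
    by rewrite (_ : j' = p) //; apply: val_inj.
  + have /andP[li _] := visits_bound v.
    have [k ek ck] := IH (Ordinal li) j' (erefl _) eqj.
    exists k => //; apply: connect_trans ck (connect1 _).
    by rewrite /= a /= -eqi -eqj ex !eqxx.
  + have li : i < n by rewrite eqi.
    have lj : j < n by have := ltn_ord j'; lia.
    have [k ek ck] := IH i' (Ordinal lj) eqi (erefl _).
    exists k => //; apply: connect_trans ck (connect1 _).
    by rewrite /= a /= -eqi -eqj ex !eqxx.
Qed.

Lemma is_reducedP D T : agree D T -> reflect (tiling_reduced n T) (is_reduced D).
Proof.
move=> a; apply: (iffP forallP) => [R|R p].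
- move=> p q i j i' j' s1 s2 s3 s4 lp lq npq c c' lj lj' v1 v2 v3 v4.
  have /andP[li _] := visits_bound v1; have /andP[li' _] := visits_bound v3.
  have npq' : Ordinal lp != Ordinal lq by apply/eqP => -[].
  move: (R (Ordinal lp)) => /forallP/(_ (Ordinal lq)); rewrite npq' /= => /card_le1_eqP h.
  have mem k l (lk : k < n) (ll : l < n) t1 t2 : T k l = Cross ->
      visits n T p k l t1 -> visits n T q k l t2 ->
      (Ordinal lk, Ordinal ll) \in crossings D (Ordinal lp) (Ordinal lq).
    move=> e w1 w2; rewrite !inE a /= e eqxx andbT.
    have mp : (Ordinal lk, Ordinal ll) \in pipe D (Ordinal lp).
      by apply/(mem_pipeP _ _ _ a); exists t1.
    have mq : (Ordinal lk, Ordinal ll) \in pipe D (Ordinal lq).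
      by apply/(mem_pipeP _ _ _ a); exists t2.
    by move: mp mq; rewrite !inE => -> ->.
  by case: (h _ _ (mem _ _ li lj _ _ c v1 v2) (mem _ _ li' lj' _ _ c' v3 v4)).
- apply/forallP => q; apply/implyP => npq; apply/card_le1_eqP.
  move=> [i j] [i' j']; rewrite /crossings.
  rewrite in_set in_setI => /andP[/andP[/(mem_pipeP _ _ _ a)[s1 v1] /(mem_pipeP _ _ _ a)[s2 v2]] /eqP c].
  rewrite in_set in_setI => /andP[/andP[/(mem_pipeP _ _ _ a)[s3 v3] /(mem_pipeP _ _ _ a)[s4 v4]] /eqP c'].
  rewrite /= !a in c c'.
  have npq' : (p : nat) <> q by move=> /val_inj e; rewrite e eqxx in npq.
  have [] := R _ _ _ _ _ _ _ _ _ _ (ltn_ord p) (ltn_ord q) npq' c c'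
    (ltn_ord j) (ltn_ord j') v1 v2 v3 v4.
  by move=> /val_inj-> /val_inj->.
Qed.

Lemma height_agree D T a b : agree D T -> b <= n ->
  height D a b = tiling_height n T a b.
Proof.
move=> ag lb; rewrite /height /tiling_height -sum1dep_card big_mkcond /=.
apply: eq_bigr => j _.
suff -> : [exists i : 'I_n, (i.+1 == b) && south (D i j)] =
          (0 < b) && south (T b.-1 j) by case: (_ && _).
apply/existsP/andP => [[i /andP[/eqP<-]]|[b0 so]]; first by rewrite ag.
have lb' : b.-1 < n by lia.
by exists (Ordinal lb'); rewrite ag /= so prednK ?eqxx.
Qed.

(** This bounded potential is raised by every move used and makes the final induction terminate. *)
Definition total_height D : nat :=
  \sum_(a < n.+1) \sum_(b < n.+1) height D a b.

Lemma total_height_le D : total_height D <= n.+1 * (n.+1 * n).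
Proof.
have bound (F : 'I_n.+1 -> nat) m : (forall i, F i <= m) -> \sum_i F i <= n.+1 * m.
  by move=> le; rewrite -[X in X * m](card_ord n.+1) -sum_nat_const leq_sum.
apply: (bound _ _) => a; apply: (bound _ _) => b.
by rewrite /height (leq_trans (max_card _)) ?card_ord.
Qed.

Section RaiseMx.
Context (i1 i2 j1 j2 : nat) (D : 'M[tile]_n) (T : nat -> nat -> tile).
Context (ag : agree D T) (lti : i1 < i2) (ltj : j1 < j2) (li : i2 < n) (lj : j2 < n).
Hypothesis ok : raisable i1 i2 j1 j2 T.
Hypothesis swap : forall i, i1 <= i < i2 -> ~~ south (T i j1) && south (T i j2).

Local Notation E := (\matrix_(i < n, j < n) raise i1 i2 j1 j2 T i j)%R.

Lemma height_raise a b : b <= n ->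
  height E a b = height D a b + ((j1 < a <= j2) && (i1 < b <= i2)).
Proof.
move=> lb; rewrite (height_agree _ ag) // (height_agree _ (agree_mx _)) //.
exact: raise_height.
Qed.

Lemma total_height_raise : total_height D < total_height E.
Proof.
rewrite /total_height.
have la : j2 < n.+1 by lia.
have lb : i2 < n.+1 by lia.
(* The grid point [(j2, i2)] is isolated: the height increases strictly there and weakly
   elsewhere. *)
rewrite (bigD1 (Ordinal la)) // [X in _ < X](bigD1 (Ordinal la)) //=.
rewrite -addSn leq_add //.
- rewrite (bigD1 (Ordinal lb)) // [X in _ < X](bigD1 (Ordinal lb)) //=.
  rewrite -addSn leq_add //.
  + by rewrite height_raise; lia.
  + by apply: leq_sum => b _; rewrite height_raise ?leq_addr // -ltnS.
- apply: leq_sum => a _; apply: leq_sum => b _.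
  by rewrite height_raise ?leq_addr // -ltnS.
Qed.

Lemma raise_mx_bpd : is_bpd D -> is_bpd E.
Proof.
move=> /(is_bpdP ag) B; apply/(is_bpdP (agree_mx _)).
exact: raise_bpd.
Qed.

Lemma raise_mx_reduced : tiling_reduced n (raise i1 i2 j1 j2 T) -> is_reduced E.
Proof. by move=> R; apply/(is_reducedP (agree_mx _)). Qed.
End RaiseMx.
End Entries.

(** * Connectedness *)

Section UndroopTiles.
Context (i1 i2 j1 j2 : nat) (T : nat -> nat -> tile) (lti : i1 < i2) (ltj : j1 < j2).
Hypothesis U : undroop_rect i1 i2 j1 j2 T.
Local Notation E := (raise i1 i2 j1 j2 T).

Lemma undroop_noelbow i j : (i1 <= i <= i2) && (j1 <= j <= j2) ->
  ~~ (((i == i1) || (i == i2)) && ((j == j1) || (j == j2))) ->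
  ~~ elbow (T i j) /\ ~~ elbow (E i j).
Proof.
case: (rect_cellP i1 i2 j1 j2 i j) => {i j} [i j b|i j b b'|||||j b|i b|j b|i b]; try lia.
- by rewrite raise_in // (undroop_in U b b').
- by rewrite raise_n //; move: (undroop_n U b); case: (T i1 j).
- by rewrite raise_w //; move: (undroop_w U b); case: (T i j1).
- by rewrite raise_s //; move: (undroop_s U b); case: (T i2 j).
- by rewrite raise_e //; move: (undroop_e U b); case: (T i j2).
Qed.

(** The right-hand side copies the body of [droop_result]: a droop of [E] gives back [T]. *)
Lemma droop_raise i j : T i j =
  if ~~ ((i1 <= i <= i2) && (j1 <= j <= j2)) then E i j
  else if (i == i1) && (j == j1) then Empty
  else if (i == i2) && (j == j2) then JElbow
  else if ((i == i1) || (i == i2)) && ((j == j1) || (j == j2)) then RElbow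
  else if i == i1 then droop_north (E i j)
  else if j == j1 then droop_west (E i j)
  else if i == i2 then droop_south (E i j)
  else if j == j2 then droop_east (E i j)
  else E i j.
Proof.
case: (rect_cellP i1 i2 j1 j2 i j) => {i j} [i j b|i j b b'|||||j b|i b|j b|i b].
- by rewrite b raise_out.
- by do 8 (rewrite ifF; last lia); rewrite raise_in.
- by rewrite ifF ?ifT ?(undroop_nw U) //; lia.
- by do 3 (rewrite ifF; last lia); rewrite ifT ?(undroop_ne U) //; lia.
- by do 3 (rewrite ifF; last lia); rewrite ifT ?(undroop_sw U) //; lia.
- by do 2 (rewrite ifF; last lia); rewrite ifT ?(undroop_se U) //; lia.
- do 4 (rewrite ifF; last lia); rewrite ifT // raise_n //.
  by move: (undroop_n U b); case: (T i1 j).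
- do 5 (rewrite ifF; last lia); rewrite ifT // raise_w //.
  by move: (undroop_w U b); case: (T i j1).
- do 6 (rewrite ifF; last lia); rewrite ifT // raise_s //.
  by move: (undroop_s U b); case: (T i2 j).
- do 7 (rewrite ifF; last lia); rewrite ifT // raise_e //.
  by move: (undroop_e U b); case: (T i j2).
Qed.
End UndroopTiles.

Section Moves.
Context (n : nat) (D : 'M[tile]_n) (T : nat -> nat -> tile) (ag : agree D T).
Local Notation mx F := (\matrix_(i < n, j < n) F i j)%R.

Lemma undroop_moves (i1 i2 j1 j2 : nat) : i1 < i2 -> j1 < j2 -> i2 < n -> j2 < n ->
  undroop_rect i1 i2 j1 j2 T ->
  undroop D (mx (raise i1 i2 j1 j2 T)) /\ droop (mx (raise i1 i2 j1 j2 T)) D.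
Proof.
move=> lti ltj li lj U; have li1 := ltn_trans lti li; have lj1 := ltn_trans ltj lj.
set E := (X in undroop D X).
have noelbow : no_noncorner_elbow (Ordinal li1) (Ordinal li) (Ordinal lj1) (Ordinal lj) D
   /\ no_noncorner_elbow (Ordinal li1) (Ordinal li) (Ordinal lj1) (Ordinal lj) E.
  split; apply/forallP => i; apply/forallP => j; rewrite ?mxE ?ag.
    apply/implyP; rewrite /in_rect /corner -!val_eqE /= => /andP[r c].
    by case: (undroop_noelbow lti ltj U r c).
  apply/implyP; rewrite /in_rect /corner -!val_eqE /= => /andP[r c].
  by case: (undroop_noelbow lti ltj U r c).
(* This one droop serves both directions, since [undroop_at] asks for the inverse droop. *)
have dr : droop_at (Ordinal li1) (Ordinal li) (Ordinal lj1) (Ordinal lj) E D.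
  rewrite /droop_at /droopable noelbow.2 !mxE /= raise_nw // raise_se //.
  rewrite (undroop_nw U) (undroop_se U) /=; apply/eqP/matrixP => i j.
  rewrite mxE ag (droop_raise lti ltj U) /in_rect /corner -!val_eqE /=.
  by rewrite mxE.
split; apply/existsP; exists (Ordinal li1); apply/existsP; exists (Ordinal li);
  apply/existsP; exists (Ordinal lj1); apply/existsP; exists (Ordinal lj);
  rewrite /= lti ltj //=.
rewrite /undroop_at dr /undroopable noelbow.1 !ag /=.
by rewrite (undroop_nw U) (undroop_ne U) (undroop_sw U) (undroop_se U).
Qed.

Lemma flip_moves (i j : nat) : i.+1 < n -> j.+1 < n ->
  is_bpd D -> raisable i i.+1 j j.+1 T ->
  (forall k, i <= k < i.+1 -> ~~ south (T k j) && south (T k j.+1)) ->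
  flip D (mx (raise i i.+1 j j.+1 T)) /\ flip (mx (raise i i.+1 j j.+1 T)) D.
Proof.
move=> li lj B ok swap; set E := (X in flip D X).
have B' : is_bpd E by exact: (raise_mx_bpd ag _ _ li lj ok B).
(* [height] takes the column first; the centre of the block is the grid point in column [j.+1] and
   row [i.+1]. *)
have h a b : b <= n -> height E a b = height D a b + ((a == j.+1) && (b == i.+1)).
  by move=> lb; rewrite (height_raise ag) //; congr (_ + _); lia.
have out (k l : 'I_n) : ~~ around j.+1 i.+1 k l -> E k l = D k l.
  by rewrite /around => o; rewrite mxE ag raise_out //; lia.
split; apply/existsP; exists (Ordinal lj); apply/existsP; exists (Ordinal li);
  rewrite /flip_at ?B ?B' /=; apply/and3P; split.
- by apply/forallP => k; apply/forallP => l; apply/implyP => /out->.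
- apply/forallP => a; apply/forallP => b; apply/implyP; rewrite xpair_eqE => ne.
  by rewrite h ?(negPf ne) ?addn0 // -ltnS.
- by rewrite h ?eqxx ?addn1 ?eqxx // ltnW.
- by apply/forallP => k; apply/forallP => l; apply/implyP => /out->.
- apply/forallP => a; apply/forallP => b; apply/implyP; rewrite xpair_eqE => ne.
  by rewrite h ?(negPf ne) ?addn0 // -ltnS.
- by rewrite h ?eqxx ?addn1 ?eqxx ?orbT // ltnW.
Qed.
End Moves.

Section Connected.
Context (n : nat).

Definition identity_mx : 'M[tile]_n := (\matrix_(i, j) identity_tiling i j)%R.

Lemma identity_mx_reduced : identity_mx \in reduced_bpds n.
Proof.
rewrite inE; apply/andP; split.
  by apply/(is_bpdP (agree_mx _)); exact: identity_bpd.
by apply/(is_reducedP (agree_mx _)); exact: identity_reduced.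
Qed.

Lemma exists_height_raising_move (D : 'M[tile]_n) :
  D \in reduced_bpds n -> D != identity_mx ->
  exists E, [/\ E \in reduced_bpds n, bpd_move D E, bpd_move E D
    & total_height D < total_height E].
Proof.
rewrite inE => /andP[bD rD] nid.
have ag := entry_agree D; set T := entry D in ag.
have B := is_bpdP ag bD; have R := is_reducedP ag rD.
have [/existsP[i /existsP[j /eqP]]|noJ] :=
    boolP [exists i : 'I_n, exists j : 'I_n, D i j == JElbow].
  rewrite ag => /eqP /(@exists_nw_minimal (fun k l => T k l == JElbow)).
  case=> i2 [j2 [/eqP eJ lei lej min]].
  have li : i2 < n by have := ltn_ord i; lia.
  have lj : j2 < n by have := ltn_ord j; lia.
  have [i1 [j1 [lti ltj U]]] := exists_undroop_rect B R li lj eJ min.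
  have ok := undroop_raisable lti ltj U.
  have [mv mv'] := undroop_moves ag lti ltj li lj U.
  exists (\matrix_(k < n, l < n) raise i1 i2 j1 j2 T k l)%R.
  split; [rewrite inE|rewrite /bpd_move mv !orbT //|rewrite /bpd_move mv' !orbT //|].
    rewrite (raise_mx_bpd ag lti ltj li lj ok bD) /=.
    exact/raise_mx_reduced/undroop_reduced.
  exact: total_height_raise ag lti ltj li lj ok (undroop_swap U).
have {}noJ i j : i < n -> j < n -> T i j != JElbow.
  move=> li lj; apply: contra noJ => e.
  by apply/existsP; exists (Ordinal li); apply/existsP; exists (Ordinal lj); rewrite ag.
have [/existsP[i /existsP[j /eqP]]|noC] :=
    boolP [exists i : 'I_n, exists j : 'I_n, D i j == Cross].
  rewrite ag => /eqP /(@exists_nw_minimal (fun k l => T k l == Cross)).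
  case=> i2 [j2 [/eqP eC lei lej min]].
  have li : i2 < n by have := ltn_ord i; lia.
  have lj : j2 < n by have := ltn_ord j; lia.
  (* A cross has north and west edges, so it lies neither in the first row nor in the first
     column. *)
  case: i2 li lei eC min => [|i2] li lei eC min; first by have := bpd_n B lj; rewrite eC.
  case: j2 lj lej eC min => [|j2] lj lej eC min; first by have := bpd_w B li; rewrite eC.
  have ok := flip_cross_raisable B noJ li lj eC min.
  have swap := flip_cross_swap B noJ li lj eC min.
  have [mv mv'] := flip_moves ag li lj bD ok swap.
  exists (\matrix_(k < n, l < n) raise i2 i2.+1 j2 j2.+1 T k l)%R.
  split; [rewrite inE|rewrite /bpd_move mv //|rewrite /bpd_move mv' //|].
    rewrite (raise_mx_bpd ag _ _ li lj ok bD) //=.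
    exact/raise_mx_reduced/flip_cross_reduced.
  exact: (total_height_raise ag _ _ li lj ok swap).
case/eqP: nid; apply/matrixP => i j; rewrite mxE ag.
apply: (identity_tilingP B) => // k l lk ll; rewrite noJ //=.
apply: contra noC => e.
by apply/existsP; exists (Ordinal lk); apply/existsP; exists (Ordinal ll); rewrite ag.
Qed.
End Connected.

Theorem theorem5p4 (n : nat) (hn : 0 < n) :
  graph_connected (reduced_bpds n) (@bpd_move n).
Proof.
have idV := identity_mx_reduced n.
split; first by apply/set0Pn; exists (identity_mx n).
set r := (X in connect X).
have edge (D E : 'M_n) : D \in reduced_bpds n -> E \in reduced_bpds n ->
    bpd_move D E -> connect r D E.
  by move=> dV eV de; apply: connect1; apply/and3P; split; assumption.
have to_id (D : 'M_n) : D \in reduced_bpds n ->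
    connect r D (identity_mx n) /\ connect r (identity_mx n) D.
  (* Induction on the gap to the bound of [total_height_le]. Paths in both directions are built
     together, each raising move coming with its reverse. *)
  have [m] := ubnP (n.+1 * (n.+1 * n) - total_height D).
  elim: m D => // m IH D lm dV.
  have [->|/(exists_height_raising_move dV)[E [eV de ed lt]]] := eqVneq D (identity_mx n).
    by split; exact: connect0.
  have [|ce ec] := IH E _ eV; first by have := total_height_le E; lia.
  split; first exact: connect_trans (edge _ _ dV eV de) ce.
  exact: connect_trans ec (edge _ _ eV dV ed).
move=> D E /to_id[cD _] /to_id[_ cE]; exact: connect_trans cD cE.
Qed.
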